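(* Let $\phi\in C_0^\infty(\mathbb{R})$ and suppose $f$ is a solution of $0=f''(x)-f^2(x)+\phi(x)$ for $x>0$ with given initial data $(f(0),f'(0))\in\mathbb{R}^2$. If $f$ does not tend to zero as $x\to\infty$, then there exists a $z$ such that $\lim_{x\to z}f(x)=\infty$. Stated another way, if $f$ solves the equation for all $x>0$, then $\lim_{x\to\infty}f(x)=0$.
   Context: $C_0^\infty(\mathbb{R})$ denotes the space of smooth real-valued functions on $\mathbb{R}$ that decay to zero at $\pm\infty$ (not necessarily compactly supported). A solution of the initial value problem is understood as the real-valued solution starting at $x=0$ continued to the right on its maximal interval of existence; ''$f$ does not tend to zero as $x\to\infty$'' includes the case in which $f$ does not exist for all $x>0$. *)

(* Defs.v *)
From Stdlib Require Import Reals.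
From Coquelicot Require Import Coquelicot.
Open Scope R_scope.

(* The space written C_0^oo(R): smooth functions vanishing at infinity; only
   the function itself, not its derivatives, is required to decay. *)
Definition smooth_vanishing (phi : R -> R) : Prop :=
  (forall (n : nat) (x : R), ex_derive_n phi n x) /\
  is_lim phi m_infty 0 /\
  is_lim phi p_infty 0.

(* [f] solves 0 = f'' - f^2 + phi on [0, b) with (f(0), f'(0)) = (y0, y1).
   Values of [f] outside [0, b) are irrelevant, so f'(0) is the right
   derivative.  [ex_derive f x] is needed separately because [ex_derive_n f 2 x]
   only says that the total function [Derive f] is differentiable at [x]. *)
Definition is_solution (phi : R -> R) (y0 y1 : R) (b : Rbar) (f : R -> R) : Prop :=
  Rbar_lt 0 b /\
  f 0 = y0 /\
  filterlim (fun h => (f h - f 0) / h) (at_right 0) (locally y1) /\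
  (forall x : R, 0 < x -> Rbar_lt x b ->
     ex_derive f x /\ ex_derive_n f 2 x /\
     0 = Derive_n f 2 x - (f x) ^ 2 + phi x).

Definition is_maximal_solution
    (phi : R -> R) (y0 y1 : R) (b : Rbar) (f : R -> R) : Prop :=
  is_solution phi y0 y1 b f /\
  (forall (c : Rbar) (g : R -> R),
     is_solution phi y0 y1 c g ->
     (forall x : R, 0 <= x -> Rbar_lt x b -> g x = f x) ->
     Rbar_le c b).

(* Main.v *)
Require Import Defs.
From Stdlib Require Import Reals Lra Psatz Classical.
From Coquelicot Require Import Coquelicot.
Open Scope R_scope.

(** Write [p = f'], so that [f' = p] and [p' = f^2 - phi].

    Global solutions.  Fix [e > 0] and look only at times so late that
    [|phi| <= e^2/8].  If at such a time [f >= e] and [p >= 0], then [f] is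
    convex as long as it stays above [e/2], hence never comes down, hence
    [f'' >= f^2/2] from then on; such a function blows up in finite time
    ([no_global_superquadratic], [no_rising_above]).  So a global solution must
    be decreasing whenever [f >= e].  Since [f'' >= e^2/2] there, it cannot
    decrease above [e] forever, and once below [e] it cannot cross back up
    ([eventually_below]).  If instead [f <= -2e], convexity turns the solution
    around at some level [<= -e], and the energy [p^2/2 - f^3/3] (nearly
    conserved, up to a term controlled by [phi]) then gives it enough speed to
    pass through the small values and to reach [e] while rising, which has
    just been excluded ([no_deep_excursion]).  Hence [|f|] is eventually smaller
    than any given positive number ([global_solution_vanishes]).

    Solutions with a finite maximal time [b].  Since [p' >= - sup |phi|],
    either [p] is bounded on the approach to [b], and then [f] and [p] have
    finite limits there, or [p] tends to infinity; in that case [f] is eventually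
    increasing, and it cannot be bounded because [p'] would then be bounded
    too, so [f] tends to infinity ([limits_or_blow_up]).  Finite limits
    contradict maximality: Picard iteration started from them at [b]
    ([local_existence]) gives a solution around [b] that continues [f]
    ([extend_past_finite_limit]). *)

(** * Growth estimates and a continuity argument *)

(** The second-order equation as a first-order system on [D]: carrying the
    derivative [p] explicitly avoids the totalised operator [Derive] and allows
    splicing solutions together. *)
Definition solves (phi f p : R -> R) (D : R -> Prop) : Prop :=
  forall x, D x -> is_derive f x (p x) /\ is_derive p x (f x ^ 2 - phi x).

(** The mean value theorem as an inequality.  The slope bound is required only
    on the open interval because it usually comes from a strict inequality
    known only before time [x]. *)
Lemma growth_lower (g dg : R -> R) (c a x : R) :
  a <= x ->
  (forall t, a <= t <= x -> is_derive g t (dg t)) ->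
  (forall t, a < t < x -> c <= dg t) ->
  g a + c * (x - a) <= g x.
Proof.
  intros Hax Hd Hc.
  destruct (Rle_lt_or_eq_dec a x Hax) as [Hlt | ->]; [| lra].
  destruct (MVT_cor2 g dg a x Hlt) as [t [Ht Hin]].
  { intros t Ht. apply is_derive_Reals, Hd, Ht. }
  specialize (Hc t Hin). nra.
Qed.

Lemma growth_upper (g dg : R -> R) (c a x : R) :
  a <= x ->
  (forall t, a <= t <= x -> is_derive g t (dg t)) ->
  (forall t, a < t < x -> dg t <= c) ->
  g x <= g a + c * (x - a).
Proof.
  intros Hax Hd Hc.
  enough (- g a + (- c) * (x - a) <= - g x) by lra.
  apply (growth_lower (fun t => - g t) (fun t => - dg t)); trivial.
  - intros t Ht. apply (is_derive_opp g), Hd, Ht.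
  - intros t Ht. specialize (Hc t Ht). lra.
Qed.

Lemma is_derive_continuous (g : R -> R) (x l : R) :
  is_derive g x l -> continuous g x.
Proof. intros H. apply (ex_derive_continuous g). now exists l. Qed.

Lemma solves_continuous (phi f p : R -> R) (D : R -> Prop) :
  solves phi f p D -> forall x, D x -> continuous f x /\ continuous p x.
Proof.
  intros Hsol x Hx. destruct (Hsol x Hx) as [Hf Hp].
  split; eapply is_derive_continuous; eassumption.
Qed.

Lemma continuous_gt_near (g : R -> R) (c x : R) :
  continuous g x -> c < g x ->
  exists d : posreal, forall y, Rabs (y - x) < d -> c < g y.
Proof.
  intros Hg Hc.
  destruct (Hg (fun y => c < y)) as [d Hd].
  - apply (open_gt c). exact Hc.
  - exists d. intros y Hy. apply Hd. exact Hy.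
Qed.

(** The continuity method: a continuous [g] leaves the region [c < g] for the
    first time at a point where [g = c], so it is enough to exclude that value
    under the assumption that [c < g] held at all earlier times. *)
Lemma bootstrap (g : R -> R) (c a : R) :
  (forall x, a <= x -> continuous g x) ->
  c < g a ->
  (forall t, a < t -> (forall s, a <= s < t -> c < g s) -> g t <> c) ->
  forall x, a <= x -> c < g x.
Proof.
  intros Hcont Ha Hstep x Hx.
  destruct (Rlt_le_dec c (g x)) as [|Hle]; [assumption | exfalso].
  set (E := fun s => a <= s <= x /\ forall r, a <= r <= s -> c < g r).
  destruct (completeness E) as [t [Hub Hlub]].
  { exists x. intros s [Hs _]. lra. }
  { exists a. split; [lra|]. intros r Hr. now replace r with a by lra. }
  assert (Hat : a <= t).
  { apply Hub. split; [lra|]. intros r Hr. now replace r with a by lra. }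
  assert (Htx : t <= x) by (apply Hlub; intros s [Hs _]; lra).
  assert (Hbelow : forall s, a <= s < t -> c < g s).
  { intros s Hs. destruct (Rlt_le_dec c (g s)) as [|Hgs]; [assumption | exfalso].
    enough (t <= s) by lra. apply Hlub. intros r [Hr Hr'].
    destruct (Rle_lt_dec r s) as [|Hsr]; [assumption | exfalso].
    specialize (Hr' s). lra. }
  assert (Hgt : c < g t).
  { destruct (Rle_lt_or_eq_dec a t Hat) as [Hlt | <-]; [| exact Ha].
    destruct (Rtotal_order (g t) c) as [Hl | [He | Hg]].
    - exfalso.
      destruct (continuous_gt_near (fun y => - g y) (- c) t) as [d Hd].
      + apply (continuous_opp g), Hcont, Hat.
      + lra.
      + pose proof (cond_pos d) as Hdpos.
        set (s := Rmax a (t - d / 2)).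
        assert (a <= s /\ t - d / 2 <= s)
          by (split; [apply Rmax_l | apply Rmax_r]).
        assert (s < t) by (apply Rmax_lub_lt; lra).
        assert (- c < - g s) by (apply Hd; rewrite Rabs_left; lra).
        specialize (Hbelow s). lra.
    - exfalso. now apply (Hstep t).
    - exact Hg. }
  destruct (continuous_gt_near g c t) as [d Hd]; [now apply Hcont | exact Hgt |].
  pose proof (cond_pos d) as Hdpos.
  set (s := Rmin x (t + d / 2)).
  assert (s <= x /\ s <= t + d / 2) by (split; [apply Rmin_l | apply Rmin_r]).
  assert (Hs : forall r, a <= r <= s -> c < g r).
  { intros r Hr. destruct (Rlt_le_dec r t); [apply Hbelow; lra |].
    apply Hd. rewrite Rabs_pos_eq; lra. }
  assert (Hts : s <= t).
  { apply Hub. split; [|exact Hs]. split; [|lra].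
    apply Rmin_glb; lra. }
  assert (s = x).
  { unfold s, Rmin in *. destruct (Rle_dec x (t + d / 2)); lra. }
  specialize (Hs x). lra.
Qed.

(** With [p = f'] this says that a uniformly convex [f] cannot keep a bounded
    slope; with [p = f] itself, that a uniformly increasing [f] is unbounded. *)
Lemma convex_slope_unbounded (p q : R -> R) (c a K : R) :
  0 < c ->
  (forall x, a <= x -> is_derive p x (q x)) ->
  (forall x, a <= x -> c <= q x) ->
  exists x, a <= x /\ K <= p x.
Proof.
  intros Hc Hd Hq.
  set (d := Rabs (K - p a) / c).
  assert (0 <= d).
  { apply Rmult_le_pos; [apply Rabs_pos | left; now apply Rinv_0_lt_compat]. }
  exists (a + d). split; [lra|].
  assert (H1 : p a + c * (a + d - a) <= p (a + d)).
  { apply (growth_lower p q); intros; [lra | apply Hd; lra | apply Hq; lra]. }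
  replace (c * (a + d - a)) with (Rabs (K - p a)) in H1
    by (unfold d; field; lra).
  pose proof (Rle_abs (K - p a)). lra.
Qed.

(** * Global solutions tend to zero *)

(** Finite-time blow-up for [f'' >= f^2/2].  The energy [f'^2 - f^3/3] does not
    decrease, so [f' >= f^(3/2)/2] once [f] has doubled; then the positive
    function [1/sqrt f] decreases at rate at least [1/4], which cannot last. *)
Lemma no_global_superquadratic (f p q : R -> R) (a : R) :
  (forall x, a <= x -> is_derive f x (p x)) ->
  (forall x, a <= x -> is_derive p x (q x)) ->
  (forall x, a <= x -> 0 < f x) ->
  (forall x, a <= x -> 0 <= p x) ->
  (forall x, a <= x -> f x ^ 2 / 2 <= q x) ->
  False.
Proof.
  intros Hf Hp Hpos Hp0 Hq.
  set (e := f a).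
  assert (He : 0 < e) by (apply Hpos; lra).
  assert (Hfe : forall x, a <= x -> e <= f x).
  { intros x Hx. enough (f a + 0 * (x - a) <= f x) by (unfold e; lra).
    apply (growth_lower f p); intuition (try apply Hf; try apply Hp0; lra). }
  assert (Hpe : forall x, a <= x -> e ^ 2 / 2 * (x - a) <= p x).
  { intros x Hx. pose proof (Hp0 a (Rle_refl a)).
    enough (p a + e ^ 2 / 2 * (x - a) <= p x) by lra.
    apply (growth_lower p q); [lra | intros; apply Hp; lra |].
    intros t Ht. assert (Hat : a <= t) by lra.
    specialize (Hfe t Hat). specialize (Hq t Hat). nra. }
  (* After time [a + 1] the slope is at least [e^2/2], so [2/e] more units of
     time add [e] to [f]. *)
  assert (Hbig : exists x1, a <= x1 /\ 2 * e <= f x1).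
  { exists (a + 1 + 2 / e).
    assert (0 < 2 / e) by (apply Rdiv_lt_0_compat; lra).
    split; [lra|].
    assert (H1 : f (a + 1) + e ^ 2 / 2 * (a + 1 + 2 / e - (a + 1))
                 <= f (a + 1 + 2 / e)).
    { apply (growth_lower f p); [lra | intros; apply Hf; lra |].
      intros t Ht. specialize (Hpe t). nra. }
    specialize (Hfe (a + 1)).
    replace (e ^ 2 / 2 * (a + 1 + 2 / e - (a + 1))) with e in H1
      by (field; lra).
    lra. }
  destruct Hbig as [x1 [Hx1 Hf1]].
  (* [f >= 2e] is used to absorb the initial energy: [e^3/3 <= f^3/24]. *)
  assert (Henergy : forall x, x1 <= x -> f x ^ 3 / 4 <= p x ^ 2).
  { intros x Hx.
    assert (HE : p a ^ 2 - f a ^ 3 / 3 + 0 * (x - a) <= p x ^ 2 - f x ^ 3 / 3).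
    { apply (growth_lower (fun t => p t ^ 2 - f t ^ 3 / 3)
               (fun t => 2 * p t * (q t - f t ^ 2 / 2))).
      - lra.
      - intros t Ht. assert (Hat : a <= t) by lra.
        pose proof (Hf t Hat) as Hft. pose proof (Hp t Hat) as Hpt.
        auto_derive.
        + repeat split; eexists; eassumption.
        + replace (Derive (fun x => f x) t) with (p t)
            by (symmetry; now apply is_derive_unique).
          replace (Derive (fun x => p x) t) with (q t)
            by (symmetry; now apply is_derive_unique).
          field.
      - intros t Ht. assert (Hat : a <= t) by lra.
        specialize (Hp0 t Hat). specialize (Hq t Hat). nra. }
    assert (2 * e <= f x).
    { enough (f x1 + 0 * (x - x1) <= f x) by lra.
      apply (growth_lower f p); [lra | |]; intros; [apply Hf | apply Hp0]; lra. }
    assert ((2 * e) ^ 3 <= f x ^ 3) by (apply pow_incr; lra).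
    fold e in HE. pose proof (pow2_ge_0 (p a)).
    assert (0 < e ^ 3) by (apply pow_lt; lra). simpl in *; nra. }
  assert (Hroot : forall x, x1 <= x -> f x * sqrt (f x) / 2 <= p x).
  { intros x Hx. assert (Hax : a <= x) by lra.
    pose proof (Hpos x Hax) as Hfx.
    pose proof (sqrt_lt_R0 _ Hfx) as Hs.
    pose proof (sqrt_sqrt (f x) (Rlt_le _ _ Hfx)) as Hss.
    apply Rsqr_incr_0; [| nra | now apply Hp0].
    specialize (Henergy x Hx). unfold Rsqr.
    replace (f x * sqrt (f x) / 2 * (f x * sqrt (f x) / 2))
      with (f x ^ 2 * (sqrt (f x) * sqrt (f x)) / 4) by field.
    rewrite Hss. lra. }
  (* The derivative of [1/sqrt f] is [- f' / (2 f^(3/2))]. *)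
  assert (Hdecr : forall x, x1 <= x ->
            / sqrt (f x) <= / sqrt (f x1) + (- (1 / 4)) * (x - x1)).
  { intros x Hx.
    apply (growth_upper (fun t => / sqrt (f t))
             (fun t => - (p t / (2 * (f t * sqrt (f t)))))).
    - exact Hx.
    - intros t Ht. assert (Hat : a <= t) by lra.
      pose proof (Hf t Hat) as Hft. pose proof (Hpos t Hat) as Hp'.
      pose proof (sqrt_lt_R0 _ Hp') as Hs.
      pose proof (sqrt_sqrt (f t) (Rlt_le _ _ Hp')) as Hss.
      auto_derive.
      + repeat split; [eexists; eassumption | assumption |].
        apply Rgt_not_eq. exact Hs.
      + replace (Derive (fun x => f x) t) with (p t)
          by (symmetry; now apply is_derive_unique).
        rewrite <- Hss at 4. field. lra.
    - intros t Ht. assert (Hxt : x1 <= t) by lra.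
      specialize (Hroot t Hxt).
      assert (Hat : a <= t) by lra.
      pose proof (Hpos t Hat) as Hp'.
      pose proof (sqrt_lt_R0 _ Hp') as Hs.
      assert (0 < f t * sqrt (f t)) by nra.
      apply Ropp_le_contravar.
      apply Rmult_le_reg_r with (2 * (f t * sqrt (f t))); [lra|].
      unfold Rdiv. rewrite (Rmult_assoc (p t)), Rinv_l by lra. lra. }
  set (r := / sqrt (f x1)).
  assert (0 < r).
  { apply Rinv_0_lt_compat, sqrt_lt_R0, Hpos, Hx1. }
  specialize (Hdecr (x1 + 4 * r)). fold r in Hdecr.
  assert (0 < / sqrt (f (x1 + 4 * r))).
  { apply Rinv_0_lt_compat, sqrt_lt_R0, Hpos. lra. }
  lra.
Qed.

(** As long as [f > e/2] the forcing is at most half of [f^2], so [f] is convex;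
    having started with nonnegative slope at height [e] it never sinks to [e/2].
    It therefore satisfies [f'' >= f^2/2] forever. *)
Lemma no_rising_above (phi f p : R -> R) (X e x0 : R) :
  0 < e ->
  (forall x, X <= x -> Rabs (phi x) <= e ^ 2 / 8) ->
  solves phi f p (Rle X) ->
  X <= x0 -> e <= f x0 -> 0 <= p x0 -> False.
Proof.
  intros He Hphi Hsol Hx0 Hf0 Hp0.
  assert (Hgap : forall t, X <= t -> e / 2 < f t ->
                   f t ^ 2 / 2 <= f t ^ 2 - phi t).
  { intros t Ht Hft. specialize (Hphi t Ht). apply Rabs_le_between in Hphi. nra. }
  assert (Hgrow : forall t, x0 <= t -> (forall s, x0 <= s < t -> e / 2 < f s) ->
             0 <= p t).
  { intros t Ht Hs.
    enough (p x0 + 0 * (t - x0) <= p t) by lra.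
    apply (growth_lower p (fun t => f t ^ 2 - phi t)); [lra | |].
    - intros s Hst. apply Hsol. lra.
    - intros s Hst. specialize (Hgap s). specialize (Hs s). nra. }
  assert (Hstay : forall x, x0 <= x -> e / 2 < f x).
  { apply bootstrap; [| lra |].
    - intros x Hx. apply (solves_continuous _ _ _ _ Hsol). lra.
    - intros t Ht Hs.
      enough (f x0 + 0 * (t - x0) <= f t) by lra.
      apply (growth_lower f p); [lra | |].
      + intros s Hst. apply Hsol. lra.
      + intros s Hst. apply Hgrow; [lra|]. intros; apply Hs; lra. }
  apply (no_global_superquadratic f p (fun t => f t ^ 2 - phi t) x0);
    intros x Hx.
  - apply Hsol; lra.
  - apply Hsol; lra.
  - specialize (Hstay x Hx). lra.
  - apply Hgrow; [lra|]. intros; apply Hstay; lra.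
  - apply Hgap; [lra|]. now apply Hstay.
Qed.

(** By [no_rising_above] the solution falls whenever it is above [e].  It cannot
    do so forever, its slope growing at rate [e^2/2], and at an upward crossing
    of the level [e] its slope would have to be nonnegative. *)
Lemma eventually_below (phi f p : R -> R) (X e : R) :
  0 < e ->
  (forall x, X <= x -> Rabs (phi x) <= e ^ 2 / 8) ->
  solves phi f p (Rle X) ->
  exists Y, X <= Y /\ forall x, Y <= x -> f x < e.
Proof.
  intros He Hphi Hsol.
  assert (Hfall : forall x, X <= x -> e <= f x -> p x < 0).
  { intros x Hx Hfx. destruct (Rlt_le_dec (p x) 0); [assumption | exfalso].
    now apply (no_rising_above phi f p X e x). }
  assert (Hex : exists Y, X <= Y /\ f Y < e).
  { apply NNPP. intros Hno.
    assert (Hall : forall x, X <= x -> e <= f x).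
    { intros x Hx. apply Rnot_lt_le. intros Hlt. apply Hno. now exists x. }
    destruct (convex_slope_unbounded p (fun t => f t ^ 2 - phi t) (e ^ 2 / 2) X 0)
      as [x [Hx Hpx]].
    - nra.
    - intros x Hx. now apply Hsol.
    - intros x Hx. specialize (Hphi x Hx). apply Rabs_le_between in Hphi.
      specialize (Hall x Hx). nra.
    - specialize (Hfall x Hx (Hall x Hx)). lra. }
  destruct Hex as [Y [HY HfY]].
  exists Y. split; [exact HY|]. intros x Hx.
  enough (- e < - f x) by lra.
  apply (bootstrap (fun t => - f t) (- e) Y); [| lra | | exact Hx].
  - intros t Ht. apply (continuous_opp f). apply (solves_continuous _ _ _ _ Hsol). lra.
  - intros t Ht Hs Heq.
    assert (Hpt : p t < 0) by (apply Hfall; lra).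
    destruct (continuous_gt_near (fun s => - p s) 0 t) as [d Hd].
    + apply (continuous_opp p). apply (solves_continuous _ _ _ _ Hsol). lra.
    + lra.
    + pose proof (cond_pos d).
      set (s := Rmax Y (t - d / 2)).
      assert (Y <= s /\ t - d / 2 <= s)
          by (split; [apply Rmax_l | apply Rmax_r]).
      assert (s < t) by (apply Rmax_lub_lt; lra).
      assert (f t <= f s + 0 * (t - s)).
      { apply (growth_upper f p); [lra | intros; apply Hsol; lra |].
        intros r Hr. assert (0 < - p r) by (apply Hd; rewrite Rabs_left; lra).
        lra. }
      specialize (Hs s). lra.
Qed.

(** Conservation of energy up to the forcing: below [- e] the solution is
    convex, so it turns around at some level [f1 <= - e].  Afterwards
    [p^2/2] exceeds its initial value by at least the integral of [s^2 - e^2/8]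
    from [f1] to the current level, which is nonnegative at every level above
    [f1] because the deep well below [- e] outweighs the small barrier near
    zero.  The slope thus never drops below its initial value, and the
    solution reaches the level [e] while rising. *)
Lemma no_deep_excursion (phi f p : R -> R) (X e x0 : R) :
  0 < e ->
  (forall x, X <= x -> Rabs (phi x) <= e ^ 2 / 8) ->
  solves phi f p (Rle X) ->
  X <= x0 -> f x0 <= - (2 * e) -> False.
Proof.
  intros He Hphi Hsol Hx0 Hf0.
  assert (Hturn : exists x1, x0 <= x1 /\ f x1 <= - e /\ 0 < p x1).
  { apply NNPP. intros Hno.
    assert (Hfall : forall x, x0 <= x -> f x <= - e -> p x <= 0).
    { intros x Hx Hfx. apply Rnot_lt_le. intros Hlt. apply Hno. now exists x. }
    assert (Hlow : forall x, x0 <= x -> e < - f x).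
    { apply bootstrap; [| lra |].
      - intros x Hx. apply (continuous_opp f). apply (solves_continuous _ _ _ _ Hsol). lra.
      - intros t Ht Hs.
        enough (f t <= f x0 + 0 * (t - x0)) by lra.
        apply (growth_upper f p); [lra | intros; apply Hsol; lra |].
        intros s Hst. apply Hfall; [lra|]. specialize (Hs s). lra. }
    destruct (convex_slope_unbounded p (fun t => f t ^ 2 - phi t) (e ^ 2 / 2) x0 1)
      as [x [Hx Hpx]].
    - nra.
    - intros x Hx. apply Hsol. lra.
    - intros x Hx. specialize (Hphi x). rewrite Rabs_le_between in Hphi.
      specialize (Hlow x Hx). nra.
    - specialize (Hlow x Hx). specialize (Hfall x Hx). lra. }
  destruct Hturn as [x1 [Hx1 [Hf1 Hp1]]].
  set (d := e ^ 2 / 8).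
  assert (Henergy : forall t, x1 <= t -> (forall s, x1 <= s < t -> 0 < p s) ->
            p x1 ^ 2 <= p t ^ 2).
  { intros t Ht Hs.
    assert (HE : (p x1 ^ 2 / 2 - f x1 ^ 3 / 3 + d * f x1) + 0 * (t - x1)
                 <= p t ^ 2 / 2 - f t ^ 3 / 3 + d * f t).
    { apply (growth_lower (fun s => p s ^ 2 / 2 - f s ^ 3 / 3 + d * f s)
               (fun s => p s * (d - phi s))).
      - lra.
      - intros s Hst. assert (HXs : X <= s) by lra.
        destruct (Hsol s HXs) as [Hfs Hps].
        auto_derive.
        + repeat split; eexists; eassumption.
        + replace (Derive (fun x => f x) s) with (p s)
            by (symmetry; now apply is_derive_unique).
          replace (Derive (fun x => p x) s) with (f s ^ 2 - phi s)
            by (symmetry; now apply is_derive_unique).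
          field.
      - intros s Hst. assert (HXs : X <= s) by lra.
        specialize (Hphi s HXs). apply Rabs_le_between in Hphi. fold d in Hphi.
        assert (0 < p s) by (apply Hs; lra). nra. }
    assert (Hft : f x1 + 0 * (t - x1) <= f t).
    { apply (growth_lower f p); [lra | intros; apply Hsol; lra |].
      intros s Hst. left. apply Hs. lra. }
    (* The second factor is the mean of [s^2 - d] over [f x1 <= s <= f t]; it is
       at least [f1^2/4 - d], since [y^2 + y f1 + f1^2 >= 3 f1^2/4] for all [y]. *)
    assert (HW : 0 <= (f t - f x1) * ((f t ^ 2 + f t * f x1 + f x1 ^ 2) / 3 - d)).
    { apply Rmult_le_pos; [lra|].
      pose proof (pow2_ge_0 (2 * f t + f x1)).
      unfold d. nra. }
    nra. }
  assert (Hup : forall x, x1 <= x -> 0 < p x).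
  { apply bootstrap; [| exact Hp1 |].
    - intros x Hx. apply (solves_continuous _ _ _ _ Hsol). lra.
    - intros t Ht Hs Hz. specialize (Henergy t). rewrite Hz in Henergy.
      specialize (Henergy (Rlt_le _ _ Ht) Hs). nra. }
  assert (Hup1 : forall x, x1 <= x -> p x1 <= p x).
  { intros x Hx. pose proof (Hup x Hx).
    assert (p x1 ^ 2 <= p x ^ 2) by (apply Henergy; [lra | intros; apply Hup; lra]).
    nra. }
  destruct (convex_slope_unbounded f p (p x1) x1 e) as [x [Hx Hfx]].
  - exact Hp1.
  - intros x Hx. apply Hsol. lra.
  - exact Hup1.
  - apply (no_rising_above phi f p X e x); trivial; [lra|].
    left. now apply Hup.
Qed.

Lemma global_solution_vanishes (phi f p : R -> R) :
  is_lim phi p_infty 0 ->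
  solves phi f p (Rlt 0) ->
  is_lim f p_infty 0.
Proof.
  intros Hphi Hsol. apply is_lim_spec. intros eps.
  pose proof (cond_pos eps) as Heps.
  set (e := eps / 3).
  assert (He : 0 < e) by (unfold e; lra).
  assert (Hd : 0 < e ^ 2 / 8) by nra.
  apply is_lim_spec in Hphi.
  destruct (Hphi (mkposreal _ Hd)) as [M HM]. simpl in HM.
  set (X := Rmax (M + 1) 1).
  assert (HX : M + 1 <= X /\ 1 <= X) by (split; [apply Rmax_l | apply Rmax_r]).
  assert (Hsmall : forall x, X <= x -> Rabs (phi x) <= e ^ 2 / 8).
  { intros x Hx. rewrite <- (Rminus_0_r (phi x)). left. apply HM. lra. }
  assert (HsolX : solves phi f p (Rle X)).
  { intros x Hx. apply Hsol. lra. }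
  destruct (eventually_below phi f p X e) as [Y [HY Hbelow]]; trivial.
  exists Y. intros x Hx. rewrite Rminus_0_r.
  apply Rabs_def1.
  - specialize (Hbelow x). unfold e in Hbelow. lra.
  - apply Rnot_le_lt. intros Hle.
    apply (no_deep_excursion phi f p X e x); trivial; unfold e in *; lra.
Qed.

(** * Local existence by Picard iteration *)

Lemma lipschitz_of_bounded_slope (g dg : R -> R) (K a b : R) :
  a <= b ->
  (forall t, a <= t <= b -> is_derive g t (dg t)) ->
  (forall t, a <= t <= b -> Rabs (dg t) <= K) ->
  Rabs (g b - g a) <= K * (b - a).
Proof.
  intros Hab Hd HK.
  assert (H1 : g a + - K * (b - a) <= g b).
  { apply (growth_lower g dg); trivial. intros t Ht.
    assert (Ht' : a <= t <= b) by lra.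
    specialize (HK t Ht'). apply Rabs_le_between in HK. lra. }
  assert (H2 : g b <= g a + K * (b - a)).
  { apply (growth_upper g dg); trivial. intros t Ht.
    assert (Ht' : a <= t <= b) by lra.
    specialize (HK t Ht'). apply Rabs_le_between in HK. lra. }
  apply Rabs_le. lra.
Qed.

Lemma deviation_from_center (g dg : R -> R) (K b r : R) :
  0 <= K ->
  (forall t, Rabs (t - b) <= r -> is_derive g t (dg t)) ->
  (forall t, Rabs (t - b) <= r -> Rabs (dg t) <= K) ->
  forall y, Rabs (y - b) <= r -> Rabs (g y - g b) <= K * r.
Proof.
  intros HK0 Hd HK y Hy. apply Rabs_le_between in Hy.
  destruct (Rle_lt_dec b y).
  - apply Rle_trans with (K * (y - b)); [| nra].
    apply (lipschitz_of_bounded_slope g dg); trivial;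
      intros t Ht; [apply Hd | apply HK]; apply Rabs_le; lra.
  - rewrite Rabs_minus_sym.
    apply Rle_trans with (K * (b - y)); [| nra].
    apply (lipschitz_of_bounded_slope g dg); [lra | |];
      intros t Ht; [apply Hd | apply HK]; apply Rabs_le; lra.
Qed.

Lemma geometric_uniform_limit (u : nat -> R -> R) :
  (forall n x, continuous (u n) x) ->
  (forall n x, Rabs (u (S n) x - u n x) <= (1 / 2) ^ n) ->
  exists v : R -> R,
    (forall x, continuous v x) /\
    (forall n x, Rabs (u n x - v x) <= 2 * (1 / 2) ^ n).
Proof.
  intros Hcont Hstep.
  assert (Hpow : forall n, 0 < (1 / 2) ^ n) by (intros; apply pow_lt; lra).
  assert (Htail : forall x n k,
    Rabs (u (n + k)%nat x - u n x) <= 2 * (1 / 2) ^ n - 2 * (1 / 2) ^ (n + k)).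
  { intros x n k. induction k as [|k IH].
    - rewrite Nat.add_0_r, !Rminus_diag, Rabs_R0. lra.
    - rewrite Nat.add_succ_r. simpl pow.
      replace (u (S (n + k)) x - u n x) with
        ((u (S (n + k)) x - u (n + k)%nat x) + (u (n + k)%nat x - u n x)) by ring.
      eapply Rle_trans; [apply Rabs_triang|].
      specialize (Hstep (n + k)%nat x). lra. }
  assert (Hsmall : forall eps : posreal, exists n, 2 * (1 / 2) ^ n < eps).
  { intros eps. destruct (pow_lt_1_zero (1 / 2)) with (y := eps / 2) as [n Hn].
    - rewrite Rabs_pos_eq; lra.
    - pose proof (cond_pos eps). lra.
    - exists n. specialize (Hn n (le_n n)).
      rewrite Rabs_pos_eq in Hn by (left; apply Hpow). lra. }
  assert (Hlim : forall x, ex_finite_lim_seq (fun n => u n x)).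
  { intros x. apply ex_lim_seq_cauchy_corr. intros eps.
    destruct (Hsmall (pos_div_2 eps)) as [N HN]. simpl in HN.
    exists N. intros n m Hn Hm.
    replace n with (N + (n - N))%nat by lia.
    replace m with (N + (m - N))%nat by lia.
    pose proof (Htail x N (n - N)%nat) as H1. pose proof (Htail x N (m - N)%nat) as H2.
    pose proof (Hpow (N + (n - N))%nat). pose proof (Hpow (N + (m - N))%nat).
    apply Rabs_le_between in H1, H2.
    apply Rabs_def1; lra. }
  set (v := fun x => real (Lim_seq (fun n => u n x))).
  assert (Hv : forall x, is_lim_seq (fun n => u n x) (v x)).
  { intros x. now apply Lim_seq_correct'. }
  assert (Hrate : forall n x, Rabs (u n x - v x) <= 2 * (1 / 2) ^ n).
  { intros n x.
    assert (Hn : forall k, u n x - 2 * (1 / 2) ^ n <= u (k + n)%nat x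
                           <= u n x + 2 * (1 / 2) ^ n).
    { intros k. pose proof (Htail x n k) as H1. rewrite Nat.add_comm in H1.
      pose proof (Hpow (k + n)%nat). apply Rabs_le_between in H1. lra. }
    pose proof (proj1 (is_lim_seq_incr_n _ n _) (Hv x)) as Hsh.
    assert (Hlo : Rbar_le (u n x - 2 * (1 / 2) ^ n) (v x)).
    { eapply is_lim_seq_le; [| apply is_lim_seq_const | exact Hsh].
      intros k. apply Hn. }
    assert (Hhi : Rbar_le (v x) (u n x + 2 * (1 / 2) ^ n)).
    { eapply is_lim_seq_le; [| exact Hsh | apply is_lim_seq_const].
      intros k. apply Hn. }
    simpl in Hlo, Hhi. apply Rabs_le. lra. }
  exists v. split; [| exact Hrate].
  intros x. apply filterlim_locally. intros eps.
  destruct (Hsmall (pos_div_2 (pos_div_2 eps))) as [n Hn]. simpl in Hn.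
  pose proof (proj1 (filterlim_locally _ _) (Hcont n x) (pos_div_2 eps)) as Hc.
  revert Hc. apply filter_imp. intros y Hy.
  change (Rabs (u n y - u n x) < eps / 2) in Hy.
  change (Rabs (v y - v x) < eps).
  pose proof (Hrate n x) as H1. pose proof (Hrate n y) as H2.
  apply Rabs_le_between in H1, H2. apply Rabs_def2 in Hy.
  apply Rabs_def1; lra.
Qed.

(** The complete space on which the Picard operator contracts.  Its members are
    functions on the whole line, so that no question of domains arises; the
    restriction to a short interval is built into the operator by [clamp]. *)
Definition near_constant (l : R) (u : R -> R) : Prop :=
  (forall x, continuous u x) /\ (forall x, Rabs (u x - l) <= 1).

(** Banach's fixed point theorem on [near_constant l].  Iteration starts from the
    constant [l], whose image is within distance 1 of it, so successive iterates
    differ by at most [(1/2)^n]. *)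
Lemma contraction_fixed_point (l : R) (T : (R -> R) -> R -> R) :
  (forall u, near_constant l u -> near_constant l (T u)) ->
  (forall u v D, near_constant l u -> near_constant l v ->
     (forall x, Rabs (u x - v x) <= D) ->
     forall x, Rabs (T u x - T v x) <= D / 2) ->
  exists u, near_constant l u /\ forall x, T u x = u x.
Proof.
  intros Hself Hcontr.
  set (it := fun n => Nat.iter n T (fun _ => l)).
  assert (H0 : near_constant l (fun _ => l)).
  { split; intros x; [apply continuous_const |].
    rewrite Rminus_diag, Rabs_R0. lra. }
  assert (Hit : forall n, near_constant l (it n)).
  { intros n. induction n as [|n IH]; [exact H0 | now apply Hself]. }
  destruct (geometric_uniform_limit it) as [u [Hu Hrate]].
  - intros n. apply Hit.
  - intros n. induction n as [|n IH]; intros x.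
    + apply (proj2 (Hit 1%nat)).
    + replace ((1 / 2) ^ S n) with ((1 / 2) ^ n / 2) by (simpl; field).
      apply (Hcontr (it (S n)) (it n)); trivial.
  - assert (Hpow : forall n, 0 < (1 / 2) ^ n) by (intros; apply pow_lt; lra).
    assert (Hzero : forall a c, 0 <= c -> (forall n, a <= c * (1 / 2) ^ n) -> a <= 0).
    { intros a c Hc Ha. apply Rnot_lt_le. intros Hpos.
      destruct (pow_lt_1_zero (1 / 2)) with (y := a / (c + 1)) as [n Hn].
      - rewrite Rabs_pos_eq; lra.
      - apply Rdiv_lt_0_compat; lra.
      - specialize (Hn n (le_n n)).
        rewrite Rabs_pos_eq in Hn by (left; apply Hpow).
        specialize (Ha n). specialize (Hpow n).
        apply (Rmult_lt_compat_l (c + 1)) in Hn; [| lra].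
        replace ((c + 1) * (a / (c + 1))) with a in Hn by (field; lra). nra. }
    assert (HK : near_constant l u).
    { split; [exact Hu|]. intros x.
      enough (Rabs (u x - l) - 1 <= 0) by lra.
      apply (Hzero _ 2); [lra|]. intros n.
      pose proof (proj2 (Hit n) x) as H1. pose proof (Hrate n x) as H2.
      apply Rabs_le_between in H1, H2.
      enough (Rabs (u x - l) <= 1 + 2 * (1 / 2) ^ n) by lra.
      apply Rabs_le. lra. }
    exists u. split; [exact HK|]. intros x.
    enough (Rabs (T u x - u x) <= 0).
    { pose proof (Rabs_pos (T u x - u x)).
      assert (Hz : Rabs (T u x - u x) = 0) by lra.
      apply Rabs_eq_0 in Hz. lra. }
    apply (Hzero _ 2); [lra|]. intros n.
    pose proof (Hcontr _ _ _ HK (Hit n)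
      (fun y => eq_ind _ (fun z => z <= _) (Hrate n y) _ (Rabs_minus_sym _ _)) x) as H1.
    pose proof (Hrate (S n) x) as H2.
    change (it (S n) x) with (T (it n) x) in H2.
    simpl pow in H2.
    apply Rabs_le_between in H1, H2. apply Rabs_le. lra.
Qed.

Lemma is_derive_integral (c b : R) (g : R -> R) :
  (forall x, continuous g x) ->
  forall x, is_derive (fun y => c + RInt g b y) x (g x).
Proof.
  intros Hg x.
  replace (g x) with (0 + g x) by ring.
  apply (is_derive_plus (fun _ => c) (fun y => RInt g b y)).
  - apply (is_derive_const c x).
  - apply (is_derive_RInt g _ b); [| apply Hg].
    apply filter_forall. intros y. apply (RInt_correct g).
    apply (ex_RInt_continuous g). intros z _. apply Hg.
Qed.

(** The projection of the line onto the interval [[b - r, b + r]]. *)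
Definition clamp (b r x : R) : R := Rmax (b - r) (Rmin (b + r) x).

Lemma clamp_near (b r x : R) : 0 <= r -> Rabs (clamp b r x - b) <= r.
Proof.
  intros Hr. unfold clamp, Rmax, Rmin.
  apply Rabs_le. repeat destruct Rle_dec; lra.
Qed.

Lemma clamp_id (b r x : R) : Rabs (x - b) <= r -> clamp b r x = x.
Proof.
  intros Hx. apply Rabs_le_between in Hx.
  unfold clamp, Rmax, Rmin. repeat destruct Rle_dec; lra.
Qed.

Lemma clamp_continuous (b r x : R) : continuous (clamp b r) x.
Proof.
  apply filterlim_locally. intros eps.
  exists eps. intros y Hy.
  change (Rabs (y - x) < eps) in Hy.
  change (Rabs (clamp b r y - clamp b r x) < eps).
  apply Rabs_def2 in Hy. pose proof (cond_pos eps).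
  unfold clamp, Rmax, Rmin. apply Rabs_def1; repeat destruct Rle_dec; lra.
Qed.

(** The fixed points of
    [u |-> l + int_b^{clamp x} (L + int_b^t (u^2 - phi))] solve the equation
    within distance [r] of [b].  The two successive integrals are the functions
    [vel] and [pos] below; all estimates on them follow from their derivatives
    and their values at [b], by the mean value theorem. *)
Lemma local_existence (phi : R -> R) (b l L : R) :
  (forall x, continuous phi x) ->
  exists (r : R) (h p : R -> R),
    0 < r /\ h b = l /\ p b = L /\
    solves phi h p (fun x => Rabs (x - b) <= r).
Proof.
  intros Hphi.
  destruct (bounded_continuity phi (b - 1) (b + 1)) as [M HM].
  { intros x _. apply Hphi. }
  assert (HM' : forall x, Rabs (x - b) <= 1 -> Rabs (phi x) <= M).
  { intros x Hx. apply Rabs_le_between in Hx. left. apply HM. lra. }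
  assert (HM0 : 0 <= M).
  { apply Rle_trans with (Rabs (phi b)); [apply Rabs_pos|]. apply HM'.
    rewrite Rminus_diag, Rabs_R0. lra. }
  set (B := Rabs l + 1). set (A := B ^ 2 + M).
  assert (HB : 1 <= B) by (pose proof (Rabs_pos l); unfold B; lra).
  assert (HA : 0 <= A) by (unfold A; nra).
  pose proof (Rabs_pos L) as HL.
  (* [B] bounds [|u|], [A] bounds [|u^2 - phi|] and [|L| + A] bounds the slope of
     [pos u].  Then [(|L| + A) r <= 1] makes the ball invariant, and
     [4 B r <= 1] with [r <= 1] gives the contraction factor
     [2 B r^2 <= 1/2]. *)
  set (r := / (4 * B + Rabs L + A)).
  assert (Hr : 0 < r) by (apply Rinv_0_lt_compat; lra).
  assert (Hr1 : (4 * B + Rabs L + A) * r = 1) by (apply Rinv_r; lra).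
  assert (Hsmall : 4 * B * r <= 1 /\ (Rabs L + A) * r <= 1 /\ r <= 1 / 4) by nra.
  destruct Hsmall as [HrB [HrA Hr4]].
  set (acc := fun (u : R -> R) s => u s ^ 2 - phi s).
  set (vel := fun u t => L + RInt (acc u) b t).
  set (pos := fun u y => l + RInt (vel u) b y).
  assert (Hacc : forall u, near_constant l u -> forall x, continuous (acc u) x).
  { intros u [Hu _] x. apply (continuous_minus (fun s => u s ^ 2) phi); [| apply Hphi].
    apply continuous_ext with (fun s => mult (u s) (u s)).
    - intros s. simpl. unfold mult. simpl. ring.
    - now apply (continuous_mult u u). }
  assert (Hvel : forall u, near_constant l u ->
            forall x, is_derive (vel u) x (acc u x)).
  { intros u Hu x. apply (is_derive_integral L b (acc u)). now apply Hacc. }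
  assert (Hpos : forall u, near_constant l u ->
            forall x, is_derive (pos u) x (vel u x)).
  { intros u Hu x. apply (is_derive_integral l b (vel u)). intros y.
    eapply is_derive_continuous. now apply Hvel. }
  assert (Hvel0 : forall u, vel u b = L).
  { intros u. unfold vel. rewrite RInt_point. unfold zero; simpl. ring. }
  assert (Hpos0 : forall u, pos u b = l).
  { intros u. unfold pos. rewrite RInt_point. unfold zero; simpl. ring. }
  assert (Habs : forall u, near_constant l u -> forall x, Rabs (u x) <= B).
  { intros u [_ Hu] x. specialize (Hu x). unfold B.
    replace (u x) with (l + (u x - l)) by ring.
    eapply Rle_trans; [apply Rabs_triang | lra]. }
  assert (Haccb : forall u, near_constant l u ->
            forall t, Rabs (t - b) <= r -> Rabs (acc u t) <= A).
  { intros u Hu t Ht. unfold acc, A.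
    assert (Ht1 : Rabs (t - b) <= 1) by lra.
    pose proof (HM' t Ht1) as H1. pose proof (Habs u Hu t) as H2.
    apply Rabs_le_between in H1, H2. apply Rabs_le. nra. }
  assert (Hvelb : forall u, near_constant l u ->
            forall t, Rabs (t - b) <= r -> Rabs (vel u t) <= Rabs L + A).
  { intros u Hu t Ht.
    assert (H1 : Rabs (vel u t - vel u b) <= A * r).
    { apply (deviation_from_center (vel u) (acc u)); trivial; intros s Hs;
        [now apply Hvel | now apply Haccb]. }
    rewrite Hvel0 in H1.
    replace (vel u t) with (L + (vel u t - L)) by ring.
    eapply Rle_trans; [apply Rabs_triang | nra]. }
  destruct (contraction_fixed_point l (fun u x => pos u (clamp b r x)))
    as [u [Hu Hfix]].
  - intros u Hu. split; intros x.
    + apply (continuous_comp (clamp b r) (pos u)); [apply clamp_continuous|].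
      eapply is_derive_continuous. now apply Hpos.
    + apply Rle_trans with ((Rabs L + A) * r); [| exact HrA].
      rewrite <- (Hpos0 u) at 1.
      apply (deviation_from_center (pos u) (vel u)); [lra | | |].
      * intros t _. now apply Hpos.
      * now apply Hvelb.
      * apply clamp_near. lra.
  - intros u v D Hu Hv HD x.
    assert (HD0 : 0 <= D).
    { apply Rle_trans with (2 := HD b). apply Rabs_pos. }
    assert (Hdv : forall t, Rabs (t - b) <= r ->
              Rabs (vel u t - vel v t) <= 2 * B * D * r).
    { intros t Ht.
      replace (vel u t - vel v t) with
        ((vel u t - vel v t) - (vel u b - vel v b)) by (rewrite !Hvel0; ring).
      apply (deviation_from_center (fun s => vel u s - vel v s)
               (fun s => acc u s - acc v s)); trivial.
      - nra.
      - intros s _. apply (is_derive_minus (vel u) (vel v)); now apply Hvel.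
      - intros s _. unfold acc.
        replace (u s ^ 2 - phi s - (v s ^ 2 - phi s))
          with ((u s + v s) * (u s - v s)) by ring.
        rewrite Rabs_mult. apply Rmult_le_compat; [apply Rabs_pos .. | | apply HD].
        eapply Rle_trans; [apply Rabs_triang|].
        pose proof (Habs u Hu s). pose proof (Habs v Hv s). lra. }
    assert (Hdp : forall t, Rabs (t - b) <= r ->
              Rabs (pos u t - pos v t) <= 2 * B * D * r * r).
    { intros t Ht.
      replace (pos u t - pos v t) with
        ((pos u t - pos v t) - (pos u b - pos v b)) by (rewrite !Hpos0; ring).
      apply (deviation_from_center (fun s => pos u s - pos v s)
               (fun s => vel u s - vel v s)); trivial.
      - assert (0 <= B * D) by nra. nra.
      - intros s _. apply (is_derive_minus (pos u) (pos v)); now apply Hpos. }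
    eapply Rle_trans; [apply Hdp, clamp_near; lra|].
    assert (0 <= D * r) by nra.
    replace (2 * B * D * r * r) with ((4 * B * r) * (D * r) / 2) by field.
    nra.
  - exists r, (pos u), (vel u).
    split; [exact Hr|]. split; [apply Hpos0|]. split; [apply Hvel0|].
    intros x Hx. split; [now apply Hpos|].
    replace (pos u x) with (u x); [now apply Hvel|].
    rewrite <- (Hfix x). now rewrite clamp_id.
Qed.

(** * Behaviour at a finite end point *)

Lemma at_left_intro (a b : R) (P : R -> Prop) :
  a < b -> (forall x, a < x < b -> P x) -> at_left b P.
Proof.
  intros Hab HP. exists (mkposreal _ (proj2 (Rlt_0_minus _ _) Hab)). simpl.
  intros x Hx Hxb. change (Rabs (x - b) < b - a) in Hx.
  apply Rabs_def2 in Hx. apply HP. lra.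
Qed.

Lemma left_limit_of_bounded_slope (g dg : R -> R) (K a b : R) :
  a < b ->
  (forall t, a <= t < b -> is_derive g t (dg t)) ->
  (forall t, a <= t < b -> Rabs (dg t) <= K) ->
  exists l : R, filterlim g (at_left b) (locally l).
Proof.
  intros Hab Hd HK.
  assert (HK0 : 0 <= K).
  { apply Rle_trans with (Rabs (dg a)); [apply Rabs_pos | apply HK; lra]. }
  apply (filterlim_locally_cauchy (U := R_CompleteSpace) (F := at_left b)).
  intros eps. pose proof (cond_pos eps) as Heps.
  set (c := Rmax a (b - eps / (K + 1))).
  assert (Hpos : 0 < eps / (K + 1)) by (apply Rdiv_lt_0_compat; lra).
  assert (Hc : a <= c /\ b - eps / (K + 1) <= c)
    by (split; [apply Rmax_l | apply Rmax_r]).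
  assert (Hcb : c < b) by (apply Rmax_lub_lt; lra).
  assert (Horder : forall u v, c < u -> u <= v -> v < b -> Rabs (g v - g u) < eps).
  { intros u v Hu Huv Hv.
    apply Rle_lt_trans with (K * (v - u)).
    - apply (lipschitz_of_bounded_slope g dg); trivial;
        intros t Ht; [apply Hd | apply HK]; lra.
    - assert (Hw : (K + 1) * (v - u) < (K + 1) * (eps / (K + 1))).
      { apply Rmult_lt_compat_l; lra. }
      replace ((K + 1) * (eps / (K + 1))) with (pos eps) in Hw by (field; lra).
      lra. }
  exists (fun x => c < x < b). split.
  - now apply (at_left_intro c b).
  - intros u v Hu Hv. change (Rabs (g v - g u) < eps).
    destruct (Rle_lt_dec u v).
    + apply Horder; lra.
    + rewrite Rabs_minus_sym. apply Horder; lra.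
Qed.

(** The slope can drop by at most [M (b - a)], where [M] bounds [|phi|].  Hence
    if it is unbounded it is eventually positive and [f] is monotone; a bounded
    [f] would make [p' = f^2 - phi], and so [p], bounded. *)
Lemma limits_or_blow_up (phi f p : R -> R) (a b : R) :
  a < b ->
  (forall x, continuous phi x) ->
  solves phi f p (fun x => a <= x < b) ->
  filterlim f (at_left b) (Rbar_locally p_infty) \/
  exists l L : R, filterlim f (at_left b) (locally l) /\
                  filterlim p (at_left b) (locally L).
Proof.
  intros Hab Hphi Hsol.
  destruct (bounded_continuity phi a b) as [M HM].
  { intros x _. apply Hphi. }
  assert (HM' : forall x, a <= x < b -> - M <= phi x <= M).
  { intros x Hx. apply Rabs_le_between. left. apply HM. lra. }
  assert (HM0 : 0 <= M) by (specialize (HM' a); lra).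
  assert (Hdrop : forall x y, a <= x -> x <= y -> y < b ->
            p x - M * (b - a) <= p y).
  { intros x y Hx Hxy Hy.
    assert (p x + - M * (y - x) <= p y).
    { apply (growth_lower p (fun t => f t ^ 2 - phi t)); trivial.
      - intros t Ht. apply Hsol. lra.
      - intros t Ht. specialize (HM' t). pose proof (pow2_ge_0 (f t)). lra. }
    nra. }
  destruct (classic (exists K, forall x, a <= x < b -> p x <= K)) as [[K HK] | Hunb].
  - right.
    set (K1 := Rmax K (M * (b - a) - p a)).
    assert (HK1 : K <= K1 /\ M * (b - a) - p a <= K1)
      by (split; [apply Rmax_l | apply Rmax_r]).
    assert (Hp : forall x, a <= x < b -> Rabs (p x) <= K1).
    { intros x Hx. specialize (HK x Hx).
      specialize (Hdrop a x). apply Rabs_le. lra. }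
    assert (HK10 : 0 <= K1).
    { apply Rle_trans with (Rabs (p a)); [apply Rabs_pos | apply Hp; lra]. }
    destruct (left_limit_of_bounded_slope f p K1 a b) as [l Hl]; trivial.
    { intros t Ht. now apply Hsol. }
    set (F := Rabs (f a) + K1 * (b - a)).
    assert (Hf : forall x, a <= x < b -> Rabs (f x) <= F).
    { intros x Hx. replace (f x) with (f a + (f x - f a)) by ring.
      eapply Rle_trans; [apply Rabs_triang|]. unfold F.
      apply Rplus_le_compat_l.
      apply Rle_trans with (K1 * (x - a)); [| nra].
      apply (lipschitz_of_bounded_slope f p); [lra | |];
        intros t Ht; [apply Hsol | apply Hp]; lra. }
    destruct (left_limit_of_bounded_slope p (fun t => f t ^ 2 - phi t)
                (F ^ 2 + M) a b) as [L HL]; trivial.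
    { intros t Ht. now apply Hsol. }
    { intros t Ht. specialize (Hf t Ht). specialize (HM' t Ht).
      apply Rabs_le_between in Hf. apply Rabs_le. nra. }
    now exists l, L.
  - left.
    assert (Hlarge : forall K, exists x, a <= x < b /\ K < p x).
    { intros K. apply NNPP. intros Hno. apply Hunb. exists K. intros x Hx.
      apply Rnot_lt_le. intros Hlt. apply Hno. now exists x. }
    destruct (Hlarge (M * (b - a))) as [c [Hc Hpc]].
    assert (Hmono : forall x y, c <= x -> x <= y -> y < b -> f x <= f y).
    { intros x y Hx Hxy Hy.
      enough (f x + 0 * (y - x) <= f y) by lra.
      apply (growth_lower f p); trivial.
      - intros t Ht. apply Hsol. lra.
      - intros t Ht. specialize (Hdrop c t). lra. }
    assert (Hreach : forall A, exists x, c <= x < b /\ A < f x).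
    { intros A. apply NNPP. intros Hno.
      assert (HfA : forall x, c <= x < b -> f x <= A).
      { intros x Hx. apply Rnot_lt_le. intros Hlt. apply Hno. now exists x. }
      set (F := Rmax A (- f c)).
      assert (HF : A <= F /\ - f c <= F) by (split; [apply Rmax_l | apply Rmax_r]).
      destruct (Hlarge (p c + (F ^ 2 + M) * (b - a) + M * (b - a)))
        as [x [Hx Hpx]].
      assert (Hslope : forall y, c <= y < b -> p y <= p c + (F ^ 2 + M) * (b - a)).
      { intros y Hy.
        assert (p y <= p c + (F ^ 2 + M) * (y - c)).
        { apply (growth_upper p (fun t => f t ^ 2 - phi t)); [lra | |].
          - intros t Ht. apply Hsol. lra.
          - intros t Ht. specialize (HfA t). specialize (HM' t).
            assert (f c <= f t) by (apply Hmono; lra).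
            assert (f t ^ 2 <= F ^ 2); [| lra].
            apply pow_maj_Rabs. apply Rabs_le. lra. }
        pose proof (pow2_ge_0 F). nra. }
      assert (Hy : c <= Rmax c x < b).
      { split; [apply Rmax_l | apply Rmax_lub_lt; lra]. }
      specialize (Hslope _ Hy). specialize (Hdrop x (Rmax c x)).
      pose proof (Rmax_r c x). lra. }
    intros P [A HA].
    destruct (Hreach A) as [x [Hx HfA]].
    apply (at_left_intro x b); [lra|]. intros y Hy. apply HA.
    apply Rlt_le_trans with (f x); [exact HfA | apply Hmono; lra].
Qed.

(** A derivative that extends continuously across a point is attained there; this
    makes two solutions that meet with the same value and slope into one. *)
Lemma derive_at_junction (g dg : R -> R) (b r : R) :
  0 < r ->
  (forall x, x <> b -> Rabs (x - b) < r -> is_derive g x (dg x)) ->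
  continuous g b ->
  continuous dg b ->
  is_derive g b (dg b).
Proof.
  intros Hr Hd Hg Hdg. apply is_derive_Reals. intros eps Heps.
  destruct (proj1 (filterlim_locally _ _) Hdg (mkposreal _ Heps)) as [d Hball].
  pose proof (cond_pos d) as Hdpos.
  assert (Hm : 0 < Rmin r d) by (apply Rmin_glb_lt; lra).
  exists (mkposreal _ Hm). simpl. intros h Hh0 Hh.
  assert (Hhr : Rabs h < r /\ Rabs h < d).
  { split; eapply Rlt_le_trans; try exact Hh; [apply Rmin_l | apply Rmin_r]. }
  assert (Hseg : forall x, Rmin b (b + h) <= x <= Rmax b (b + h) ->
            Rabs (x - b) <= Rabs h).
  { intros x Hx. unfold Rmin, Rmax in Hx.
    destruct (Rle_dec b (b + h));
      [rewrite (Rabs_pos_eq h) by lra | rewrite (Rabs_left h) by lra];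
      apply Rabs_le; lra. }
  destruct (MVT_gen g b (b + h) dg) as [c [Hc Heq]].
  - intros x Hx. apply Hd.
    + unfold Rmin, Rmax in Hx. destruct (Rle_dec b (b + h)); lra.
    + assert (Rabs (x - b) <= Rabs h) by (apply Hseg; lra). lra.
  - intros x Hx. apply continuity_pt_filterlim.
    destruct (Req_dec x b) as [-> | Hne]; [exact Hg|].
    eapply is_derive_continuous. apply Hd; [exact Hne|].
    specialize (Hseg x Hx). lra.
  - rewrite Heq. replace (dg c * (b + h - b) / h) with (dg c) by (field; lra).
    apply Hball. change (Rabs (c - b) < d).
    specialize (Hseg c Hc). lra.
Qed.

Definition splice (b : R) (f h : R -> R) (x : R) : R :=
  if Rlt_dec x b then f x else h x.

Lemma splice_left (b : R) (f h : R -> R) (x : R) : x < b -> splice b f h x = f x.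
Proof. intros Hx. unfold splice. destruct (Rlt_dec x b); [reflexivity | lra]. Qed.

Lemma splice_right (b : R) (f h : R -> R) (x : R) : b <= x -> splice b f h x = h x.
Proof. intros Hx. unfold splice. destruct (Rlt_dec x b); [lra | reflexivity]. Qed.

Lemma locally_lt (x b : R) : x < b -> locally x (fun y => y < b).
Proof. intros Hx. now apply (open_lt b). Qed.

Lemma locally_gt (x b : R) : b < x -> locally x (fun y => b < y).
Proof. intros Hx. now apply (open_gt b). Qed.

Lemma splice_continuous (b : R) (f h : R -> R) :
  filterlim f (at_left b) (locally (h b)) -> continuous h b ->
  continuous (splice b f h) b.
Proof.
  intros Hf Hh P HP. rewrite splice_right in HP by lra.
  specialize (Hf P HP). specialize (Hh P HP).
  unfold filtermap, at_left, within in *.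
  generalize (filter_and _ _ Hf Hh). apply filter_imp.
  intros x [H1 H2]. unfold splice. destruct (Rlt_dec x b); auto.
Qed.

Lemma splice_derive_off_junction (b : R) (f h df dh : R -> R) (x : R) :
  (x < b -> is_derive f x (df x)) ->
  (b < x -> is_derive h x (dh x)) ->
  x <> b ->
  is_derive (splice b f h) x (splice b df dh x).
Proof.
  intros Hf Hh Hne. destruct (Rlt_le_dec x b) as [Hlt | Hle].
  - rewrite splice_left by exact Hlt.
    apply (is_derive_ext_loc f); [| now apply Hf].
    generalize (locally_lt x b Hlt). apply filter_imp.
    intros y Hy. now rewrite splice_left.
  - assert (Hlt : b < x) by lra.
    rewrite splice_right by exact Hle.
    apply (is_derive_ext_loc h); [| now apply Hh].
    generalize (locally_gt x b Hlt). apply filter_imp.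
    intros y Hy. rewrite splice_right; [reflexivity | lra].
Qed.

(** The continuation of [f] by the local solution [h] with data [(l, L)] at [b].
    Away from [b] it coincides locally with [f] or with [h]; at [b],
    [derive_at_junction] is applied first to the solution and then, the new
    right-hand side being continuous, to its slope. *)
Lemma extend_past_finite_limit (phi f p : R -> R) (a b l L : R) :
  a < b ->
  (forall x, continuous phi x) ->
  solves phi f p (fun x => a < x < b) ->
  filterlim f (at_left b) (locally l) ->
  filterlim p (at_left b) (locally L) ->
  exists (r : R) (g q : R -> R),
    0 < r /\ (forall x, x < b -> g x = f x) /\
    solves phi g q (fun x => a < x < b + r).
Proof.
  intros Hab Hphi Hsol Hf Hp.
  destruct (local_existence phi b l L Hphi) as (r & h & s & Hr & Hh & Hs & Hloc).
  destruct (solves_continuous _ _ _ _ Hloc b) as [Hhc Hsc].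
  { rewrite Rminus_diag, Rabs_R0. lra. }
  set (g := splice b f h). set (q := splice b p s).
  assert (Hg : continuous g b) by (apply splice_continuous; [now rewrite Hh | exact Hhc]).
  assert (Hq : continuous q b) by (apply splice_continuous; [now rewrite Hs | exact Hsc]).
  assert (Hoff : forall x, a < x < b + r -> x <> b ->
            is_derive g x (q x) /\ is_derive q x (g x ^ 2 - phi x)).
  { intros x Hx Hne.
    assert (Hright : b < x -> Rabs (x - b) <= r) by (intros; apply Rabs_le; lra).
    split.
    - apply splice_derive_off_junction; trivial; intros Hxb.
      + apply Hsol. lra.
      + now apply Hloc, Hright.
    - replace (g x ^ 2 - phi x)
        with (splice b (fun t => f t ^ 2 - phi t) (fun t => h t ^ 2 - phi t) x)
        by (unfold g, splice; destruct (Rlt_dec x b); reflexivity).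
      apply splice_derive_off_junction; trivial; intros Hxb.
      + apply Hsol. lra.
      + now apply Hloc, Hright. }
  exists r, g, q. split; [exact Hr|].
  split; [intros x Hx; now apply splice_left|].
  intros x Hx. destruct (Req_dec x b) as [-> | Hne]; [| now apply Hoff].
  assert (Hm : 0 < Rmin r (b - a)) by (apply Rmin_glb_lt; lra).
  assert (Hnear : forall y, Rabs (y - b) < Rmin r (b - a) -> a < y < b + r).
  { intros y Hy. apply Rabs_def2 in Hy.
    pose proof (Rmin_l r (b - a)). pose proof (Rmin_r r (b - a)). lra. }
  split.
  - apply (derive_at_junction g q b _ Hm); trivial.
    intros y Hne Hy. apply Hoff; [now apply Hnear | exact Hne].
  - apply (derive_at_junction q (fun t => g t ^ 2 - phi t) b _ Hm); trivial.
    + intros y Hne Hy. apply Hoff; [now apply Hnear | exact Hne].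
    + apply (continuous_minus (fun t => g t ^ 2) phi); [| apply Hphi].
      apply continuous_ext with (fun t => mult (g t) (g t)).
      * intros t. unfold mult. simpl. ring.
      * now apply (continuous_mult g g).
Qed.

(** * Continuation of maximal solutions *)

Lemma solves_of_is_solution (phi f : R -> R) (y0 y1 : R) (b : Rbar) :
  is_solution phi y0 y1 b f ->
  solves phi f (Derive f) (fun x => 0 < x /\ Rbar_lt x b).
Proof.
  intros (_ & _ & _ & Hode) x [Hx Hxb].
  destruct (Hode x Hx Hxb) as (H1 & H2 & Heq). split.
  - now apply Derive_correct.
  - replace (f x ^ 2 - phi x) with (Derive_n f 2 x) by lra.
    apply (Derive_correct (Derive f)). exact H2.
Qed.

Lemma is_solution_extension (phi f g q : R -> R) (y0 y1 b c : R) :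
  is_solution phi y0 y1 b f ->
  b <= c ->
  (forall x, x < b -> g x = f x) ->
  solves phi g q (fun x => 0 < x < c) ->
  is_solution phi y0 y1 c g.
Proof.
  intros (Hb & Hf0 & Hf1 & _) Hbc Heq Hsol. simpl in Hb.
  split; [simpl; lra|]. split; [now rewrite Heq|]. split.
  - apply (filterlim_ext_loc (fun h => (f h - f 0) / h)); [| exact Hf1].
    apply filter_le_within.
    generalize (locally_lt 0 b Hb). apply filter_imp.
    intros h Hh. rewrite !Heq; trivial.
  - intros x Hx Hxc. simpl in Hxc.
    destruct (Hsol x (conj Hx Hxc)) as [Hg Hq].
    assert (Hq2 : is_derive (Derive g) x (g x ^ 2 - phi x)).
    { apply (is_derive_ext_loc q); [| exact Hq].
      generalize (filter_and _ _ (locally_lt x c Hxc) (locally_gt x 0 Hx)).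
      apply filter_imp. intros y [Hyc Hy]. symmetry.
      apply is_derive_unique. now apply Hsol. }
    split; [now exists (q x)|]. split.
    + exists (g x ^ 2 - phi x). exact Hq2.
    + replace (Derive_n g 2 x) with (g x ^ 2 - phi x); [ring|].
      symmetry. now apply (is_derive_unique (Derive g)).
Qed.

Theorem theorem7 (phi : R -> R) (Hphi : smooth_vanishing phi)
    (y0 y1 : R) (f : R -> R) :
  (forall b : Rbar,
     is_maximal_solution phi y0 y1 b f ->
     ~ (b = p_infty /\ is_lim f p_infty 0) ->
     exists z : R,
       b = Finite z /\ filterlim f (at_left z) (Rbar_locally p_infty))
  /\
  (is_solution phi y0 y1 p_infty f -> is_lim f p_infty 0).
Proof.
  destruct Hphi as (Hsmooth & _ & Hinf).
  assert (Hcont : forall x, continuous phi x).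
  { intros x. apply (ex_derive_continuous phi). exact (Hsmooth 1%nat x). }
  assert (Hglobal : is_solution phi y0 y1 p_infty f -> is_lim f p_infty 0).
  { intros Hf. apply (global_solution_vanishes phi f (Derive f) Hinf).
    intros x Hx. now apply (solves_of_is_solution _ _ _ _ _ Hf). }
  split; [| exact Hglobal].
  intros b [Hf Hmax] Hnot.
  destruct b as [b | |]; [| now exfalso; auto | now destruct Hf].
  exists b. split; [reflexivity|].
  assert (Hb : 0 < b) by apply Hf.
  pose proof (solves_of_is_solution _ _ _ _ _ Hf) as Hsol. simpl in Hsol.
  destruct (limits_or_blow_up phi f (Derive f) (b / 2) b)
    as [Hup | (l & L & Hl & HL)]; trivial.
  - lra.
  - intros x Hx. apply Hsol. lra.
  - exfalso.
    destruct (extend_past_finite_limit phi f (Derive f) 0 b l L)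
      as (r & g & q & Hr & Heq & Hg); trivial.
    enough (Hle : Rbar_le (Finite (b + r)) (Finite b)) by (simpl in Hle; lra).
    apply (Hmax (b + r) g).
    + apply (is_solution_extension phi f g q y0 y1 b); trivial. lra.
    + intros x _ Hx. now apply Heq.
Qed.
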